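(* Let $\mathbb{F}$ be a field and $\mathbf{Vec}$ the category of finite-dimensional $\mathbb{F}$-vector spaces. Let $\mathcal{B}$ be the set of finite barcodes, $d_B$ the bottleneck distance on $\mathcal{B}$, and $d$ the interleaving distance on functors $(\mathbb{R},\leq)\to\mathbf{Vec}$. The mapping $\chi$ defined by $\chi(\{I_k\}_{k=1}^n)=\bigoplus_{k=1}^n\chi_{I_k}$ is an isometric embedding of $(\mathcal{B},d_B)$ into the objects of $\mathbf{Vec}^{(\mathbb{R},\leq)}$ with the distance $d$, in the sense that $$d(\chi(B),\chi(B'))=d_B(B,B')\quad\text{for all } B,B'\in\mathcal{B}.$$
   Context: $(\mathbb{R},\leq)$ denotes the poset of real numbers viewed as a category, and $\mathbf{Vec}^{(\mathbb{R},\leq)}$ is the category of functors $(\mathbb{R},\leq)\to\mathbf{Vec}$. For an interval $I\subseteq\mathbb{R}$ (possibly empty, bounded or unbounded, with or without endpoints), the diagram $\chi_I:(\mathbb{R},\leq)\to\mathbf{Vec}$ is given by $\chi_I(a)=\mathbb{F}$ if $a\in I$ and $0$ otherwise, and $\chi_I(a\leq b)=\mathrm{Id}_{\mathbb{F}}$ if $a,b\in I$ and $0$ otherwise. For $b\geq 0$, $T_b:(\mathbb{R},\leq)\to(\mathbb{R},\leq)$ is the functor $T_b(a)=a+b$. For $\varepsilon\geq 0$, functors $F,G:(\mathbb{R},\leq)\to\mathbf{Vec}$ are $\varepsilon$-interleaved if there are natural transformations $\varphi:F\Rightarrow GT_\varepsilon$ and $\psi:G\Rightarrow FT_\varepsilon$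 such that for all $a\in\mathbb{R}$, $\psi(a+\varepsilon)\varphi(a)=F(a\leq a+2\varepsilon)$ and $\varphi(a+\varepsilon)\psi(a)=G(a\leq a+2\varepsilon)$. The interleaving distance is $d(F,G)=\inf\{\varepsilon\geq 0\mid F\text{ and }G\text{ are }\varepsilon\text{-interleaved}\}$, equal to $\infty$ if there is no such $\varepsilon$. A barcode is a multiset of intervals in $\mathbb{R}$; a finite barcode is a finite multiset of intervals (which need not be bounded). Given multisets $A$ and $B$, $A_B$ denotes the disjoint union of $A$ and the multiset containing the empty interval $\emptyset$ with multiplicity $|B|$. A stable bijection (partial matching) $f:A\rightleftharpoons B$ is a bijection $f:A_B\to B_A$ (so $\operatorname{dom} f=A_B$). The bottleneck distance between barcodes $B$ and $B'$ is $d_B(B,B')=\inf_{f:B\rightleftharpoons B'}\ \sup_{I\in\operatorname{dom} f} d(\chi_I,\chi_{f(I)})$, where the supremum over the empty set is $0$. *)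

(* Defs.v *)
From HB Require Import structures.
From mathcomp Require Import all_boot all_order all_algebra.
From mathcomp Require Import finmap multiset.
From mathcomp Require Import all_classical all_reals all_analysis.

Set Implicit Arguments.
Unset Strict Implicit.
Unset Printing Implicit Defensive.

Import Order.TTheory GRing.Theory Num.Theory.

Local Open Scope classical_set_scope.
Local Open Scope ring_scope.

Section Diagrams.
Variables (R : realType) (F : fieldType).

(* Functors from the poset (R, <=) to finite-dimensional F-vector spaces; the
   proof of [a <= b] is irrelevant, since [<=] is boolean. *)
Record diagram := Diagram {
  dobj :> R -> vectType F;
  dmap : forall a b : R, a <= b -> 'Hom(dobj a, dobj b);
  dmap_id : forall (a : R) (h : a <= a), dmap h = \1%VF;
  dmap_comp : forall (a b c : R) (hab : a <= b) (hbc : b <= c) (hac : a <= c),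
    dmap hac = (dmap hbc \o dmap hab)%VF }.

Record nat_trans (M N : diagram) := NatTrans {
  ntcomp :> forall a : R, 'Hom(M a, N a);
  nt_natural : forall (a b : R) (h : a <= b),
    (ntcomp b \o dmap M h)%VF = (dmap N h \o ntcomp a)%VF }.

(* The composite M T_e. *)
Section Shift.
Variables (M : diagram) (e : R).

Lemma shift_le (a b : R) : a <= b -> a + e <= b + e.
Proof. by rewrite lerD2r. Qed.

Definition shift_map (a b : R) (h : a <= b) : 'Hom(M (a + e), M (b + e)) :=
  dmap M (shift_le h).

Lemma shift_map_id (a : R) (h : a <= a) : shift_map h = \1%VF.
Proof. exact: dmap_id. Qed.

Lemma shift_map_comp (a b c : R) (hab : a <= b) (hbc : b <= c) (hac : a <= c) :
  shift_map hac = (shift_map hbc \o shift_map hab)%VF.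
Proof. exact: dmap_comp. Qed.

Definition shift : diagram := Diagram shift_map_id shift_map_comp.
End Shift.

Lemma le_shift2 (e : R) : 0 <= e -> forall a : R, a <= a + e + e.
Proof. by move=> e0 a; rewrite -addrA lerDl addr_ge0. Qed.

(* [a + 2e] is written [a + e + e], the point at which the composites land. *)
Definition interleaved (e : R) (M N : diagram) : Prop :=
  exists (he : 0 <= e)
         (phi : nat_trans M (shift N e)) (psi : nat_trans N (shift M e)),
    (forall a : R, (psi (a + e) \o phi a)%VF = dmap M (le_shift2 he a)) /\
    (forall a : R, (phi (a + e) \o psi a)%VF = dmap N (le_shift2 he a)).

Definition interleaving_distance (M N : diagram) : \bar R :=
  ereal_inf [set e%:E | e in [set e : R | interleaved e M N]].

Section DirectSum.
Variables (M N : diagram).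

Definition dsum_map (a b : R) (h : a <= b) :
    'Hom((M a * N a)%type, (M b * N b)%type) :=
  linfun (fun x : M a * N a => (dmap M h x.1, dmap N h x.2)).

Lemma dsum_mapE (a b : R) (h : a <= b) (x : (M a * N a)%type) :
  dsum_map h x = (dmap M h x.1, dmap N h x.2).
Proof.
pose f (x : M a * N a) := (dmap M h x.1, dmap N h x.2).
have lf : linear f by move=> k u v; rewrite /f /= !linearP.
pose fL := GRing.isLinear.Build F _ _ *:%R f lf.
pose g : {linear (M a * N a)%type -> (M b * N b)%type} := HB.pack f fL.
exact: (lfunE g x).
Qed.

Lemma dsum_map_id (a : R) (h : a <= a) : dsum_map h = \1%VF.
Proof. by apply/lfunP => -[x y]; rewrite dsum_mapE !dmap_id !id_lfunE. Qed.

Lemma dsum_map_comp (a b c : R) (hab : a <= b) (hbc : b <= c) (hac : a <= c) :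
  dsum_map hac = (dsum_map hbc \o dsum_map hab)%VF.
Proof.
apply/lfunP => x.
by rewrite comp_lfunE !dsum_mapE /= (dmap_comp M hab hbc) (dmap_comp N hab hbc)
  !comp_lfunE.
Qed.

Definition dsum : diagram :=
  @Diagram (fun a => (M a * N a)%type : vectType F) dsum_map
    dsum_map_id dsum_map_comp.
End DirectSum.

Definition dzero_map (a b : R) (h : a <= b) : 'Hom('rV[F]_0, 'rV[F]_0) := \1%VF.

Lemma dzero_map_id (a : R) (h : a <= a) : dzero_map h = \1%VF.
Proof. by []. Qed.

Lemma dzero_map_comp (a b c : R) (hab : a <= b) (hbc : b <= c) (hac : a <= c) :
  dzero_map hac = (dzero_map hbc \o dzero_map hab)%VF.
Proof. by rewrite /dzero_map comp_lfun1l. Qed.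

Definition dzero : diagram :=
  @Diagram (fun=> 'rV[F]_0 : vectType F) dzero_map dzero_map_id dzero_map_comp.

Definition big_dsum (s : seq diagram) : diagram := foldr dsum dzero s.

End Diagrams.

(* Arbitrary intervals of R (possibly empty, unbounded, with or without
   endpoints) as order-convex subsets. *)
Record rinterval (R : realType) := RInterval {
  rset : set R;
  rsetP : is_interval rset }.

HB.instance Definition _ (R : realType) := gen_eqMixin (rinterval R).
HB.instance Definition _ (R : realType) := gen_choiceMixin (rinterval R).

Lemma is_interval_set0 (R : realType) : is_interval (@set0 R).
Proof. by []. Qed.

Definition itv_empty (R : realType) : rinterval R :=
  RInterval (@is_interval_set0 R).

Section IntervalDiagram.
Variables (R : realType) (F : fieldType) (I : rinterval R).

Definition fiber (p : bool) : vectType F :=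
  if p then (F^o : vectType F) else ('rV[F]_0 : vectType F).

Definition fiber_map (p q : bool) : 'Hom(fiber p, fiber q) :=
  match p, q with
  | true, true => \1%VF
  | _, _ => 0
  end.

Definition chi_itv_map (a b : R) (h : a <= b) :
    'Hom(fiber (a \in rset I), fiber (b \in rset I)) :=
  fiber_map (a \in rset I) (b \in rset I).

Lemma chi_itv_map_id (a : R) (h : a <= a) : chi_itv_map h = \1%VF.
Proof.
rewrite /chi_itv_map; case: (_ \in _) => //=.
by apply/lfunP => x; apply/rowP => -[].
Qed.

Lemma chi_itv_map_comp (a b c : R)
    (hab : a <= b) (hbc : b <= c) (hac : a <= c) :
  chi_itv_map hac = (chi_itv_map hbc \o chi_itv_map hab)%VF.
Proof.
rewrite /chi_itv_map.
have : (a \in rset I) -> (c \in rset I) -> (b \in rset I).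
  rewrite !inE => Ia Ic.
  by apply: (rsetP Ia Ic); rewrite hab hbc.
move: (a \in rset I) (b \in rset I) (c \in rset I) => [] [] [] /= H;
  rewrite ?comp_lfun0l ?comp_lfun0r ?comp_lfun1l //.
by move: (H isT isT).
Qed.

Definition chi_itv : diagram R F :=
  @Diagram R F (fun a => fiber (a \in rset I)) chi_itv_map
    chi_itv_map_id chi_itv_map_comp.
End IntervalDiagram.

Definition fin_barcode (R : realType) : Type := {mset (rinterval R)}%mset.
Identity Coercion mset_of_fin_barcode : fin_barcode >-> multiset_of.

Section Barcodes.
Variables (R : realType) (F : fieldType).

Definition chi (B : fin_barcode R) : diagram R F :=
  big_dsum [seq chi_itv F J | J <- enum_mset B].

(* A_B : the multiset A together with |B| copies of the empty interval. *)
Definition padded (A B : fin_barcode R) : fin_barcode R :=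
  (A `+` msetn (size B) (itv_empty R))%mset.

(* The elements of a multiset, counted with multiplicity: pairs of an interval
   I and a copy number below the multiplicity of I. *)
Definition occ (A : fin_barcode R) : Type := {I : rinterval R & 'I_(A I)}.

Definition occ_itv (A : fin_barcode R) (x : occ A) : rinterval R := tag x.

Record stable_bijection (A B : fin_barcode R) := StableBijection {
  sbij :> occ (padded A B) -> occ (padded B A);
  sbijP : bijective sbij }.

(* [ereal_sup set0 = -oo], so 0 is adjoined to give the empty supremum its
   value 0; this changes no other supremum, as distances are nonnegative. *)
Definition matching_cost (A B : fin_barcode R) (f : stable_bijection A B) : \bar R :=
  ereal_sup (0%E |`
    [set interleaving_distance (chi_itv F (occ_itv x)) (chi_itv F (occ_itv (f x)))
      | x in [set: occ (padded A B)]]).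

Definition bottleneck_distance (A B : fin_barcode R) : \bar R :=
  ereal_inf [set matching_cost f | f in [set: stable_bijection A B]].

End Barcodes.

(* Main.v *)
From HB Require Import structures.
Require Import Defs.
From mathcomp Require Import all_boot all_order all_algebra.
From mathcomp Require Import finmap multiset.
From mathcomp Require Import all_classical all_reals all_analysis.
From mathcomp Require Import lra.

Set Implicit Arguments.
Unset Strict Implicit.
Unset Printing Implicit Defensive.

Import Order.TTheory GRing.Theory Num.Theory.

Local Open Scope ring_scope.

(** Interleavings are handled through coefficients.  The module [chi F B] has,
    at each parameter, a basis indexed by the intervals of [B] (an interval
    contributes the zero vector where it is not alive), so that an interleaving
    is a pair of matrices of functions of the parameter ([interleavedP]).
    A morphism between two interval modules is a scalar wherever both are
    alive, so each entry reduces to one number ([mat_morphism_scalar]).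

    That the interleaving distance is at most the bottleneck distance holds
    because direct sums of interleavings are interleavings
    ([bijection_interleaved]).

    For the converse, fix an [e]-interleaving and [e' > e], and call an interval
    negligible if it dies within [2 e'].  Two intervals may be matched when
    their endpoints are [e']-close or both are negligible; matched intervals
    are then [e']-interleaved.  A matching of all of [B] with all of [B'],
    padded with empty intervals to equal size, comes from Hall's theorem.
    Its condition has to be checked only for a set [A] of non-negligible
    intervals: if a set contains a negligible interval, its neighbourhood
    contains all negligible ones on the other side, and the condition for the
    complement of the neighbourhood gives what is needed
    ([interleaved_matching]).

    For non-negligible [A] the condition is a rank bound
    ([card_significant]).  The composite of the two scalar matrices, restricted
    to [A], is the identity where the composite of modules can be nonzero.
    Order [A] by which ends are infinite, and then by the sum of the finite
    ends ([itv_key]).  If there are nonzero morphisms from [I] to [J] and from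
    [J] to [K] (up to shifts by [e]) and the key of [I] is at most that of
    [K], then [J] is [e']-close to [I] or to [K] ([close_to_end]), so on one
    side of the diagonal only the neighbours of [A] contribute to the
    composite, and the product of the two blocks through these neighbours is
    unitriangular.  Hence [A] has at least [#|A|]
    neighbours ([unitriangular_product_card]).  This is Bjerkevik's proof of
    the stability of interval decomposable modules, in one parameter. *)

(** * Hall's marriage theorem *)

Section Hall.
Import mathcomp.boot.finset.
Variables T T' : finType.
Implicit Types (E : {set T * T'}) (S : {set T}).

Definition nbhd E S : {set T'} := [set y | [exists x in S, (x, y) \in E]].

Lemma nbhdP E S y :
  reflect (exists2 x, x \in S & (x, y) \in E) (y \in nbhd E S).
Proof. by rewrite inE; apply: exists_inP. Qed.

Lemma nbhd_remove_notin E S x y : x \notin S -> nbhd (E :\ (x, y)) S = nbhd E S.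
Proof.
move=> xS; apply/setP => z; apply/nbhdP/nbhdP => -[w wS wE]; exists w => //.
  by move: wE; rewrite in_setD1 => /andP[].
rewrite in_setD1 wE andbT xpair_eqE negb_and; apply/orP; left.
by apply: contraNneq xS => <-.
Qed.

(** Rado's argument: if the removal of either of two edges at [x] creates
    violating sets, submodularity of the neighbourhood size contradicts the
    marriage condition; so edges can be removed until each [x] has a single
    neighbour. *)
Lemma hall_marriage E :
  (forall S, (#|S| <= #|nbhd E S|)%N) ->
  exists f : T -> T', injective f /\ forall x, (x, f x) \in E.
Proof.
have [n] := ubnP #|E|; elim: n E => // n IHn E /ltnSE leEn hallE.
have [[x [y1 [y2 [xy1 xy2 y12]]]]|uniqE] :=
  pselect (exists x y1 y2, [/\ (x, y1) \in E, (x, y2) \in E & y1 != y2]).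
  have removal y : (x, y) \in E ->
      (exists f : T -> T', injective f /\ forall z, (z, f z) \in E) \/
      exists2 A : {set T}, x \notin A &
        (#|nbhd (E :\ (x, y)) (x |: A)| <= #|A|)%N.
    move=> xyE.
    have [hallE'|/existsNP[S /negP]] :=
      pselect (forall S, (#|S| <= #|nbhd (E :\ (x, y)) S|)%N).
      left; have [|f [injf fE]] := IHn (E :\ (x, y)) _ hallE'.
        by move: leEn; rewrite (cardsD1 (x, y) E) xyE.
      by exists f; split=> // z; have := fE z; rewrite in_setD1 => /andP[].
    rewrite -ltnNge => ltS.
    have xS : x \in S.
      apply: contraTT ltS => xS.
      by rewrite nbhd_remove_notin // -leqNgt.
    right; exists (S :\ x); first by rewrite setD11.
    by rewrite setD1K //; move: ltS; rewrite (cardsD1 x S) xS.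
  have [//|[A1 xA1 le1]] := removal _ xy1.
  have [//|[A2 xA2 le2]] := removal _ xy2.
  (* Only [x] can reach [y1] or [y2] through a removed edge, and each removed
     edge survives in the other graph. *)
  set N1 := nbhd _ _ in le1; set N2 := nbhd _ _ in le2.
  have sU : nbhd E (x |: (A1 :|: A2)) \subset N1 :|: N2.
    apply/fintype.subsetP => z /nbhdP[w wA wz]; rewrite in_setU.
    have in1 : w \in x |: A1 -> (w, z) != (x, y1) -> z \in N1.
      by move=> ? ne; apply/nbhdP; exists w; rewrite // in_setD1 ne.
    have in2 : w \in x |: A2 -> (w, z) != (x, y2) -> z \in N2.
      by move=> ? ne; apply/nbhdP; exists w; rewrite // in_setD1 ne.
    have [wx|wx] := eqVneq w x.
      subst w; have [zy1|zy1] := eqVneq z y1.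
        apply/orP; right; apply: in2; first exact: setU11.
        by rewrite zy1 xpair_eqE eqxx.
      apply/orP; left; apply: in1; first exact: setU11.
      by rewrite xpair_eqE negb_and zy1 orbT.
    rewrite !inE (negPf wx) /= in wA; case/orP: wA => wA; apply/orP.
      by left; apply: in1; rewrite ?xpair_eqE ?(negPf wx) // !inE wA orbT.
    by right; apply: in2; rewrite ?xpair_eqE ?(negPf wx) // !inE wA orbT.
  have sI : nbhd E (A1 :&: A2) \subset N1 :&: N2.
    apply/fintype.subsetP => z /nbhdP[w]; rewrite inE => /andP[w1 w2] wz.
    have wx : w != x by apply: contraNneq xA1 => <-.
    rewrite inE; apply/andP; split; apply/nbhdP; exists w;
      by rewrite ?inE ?xpair_eqE ?w1 ?w2 ?(negPf wx) ?orbT.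
  have := leq_trans (hallE _) (subset_leq_card sU).
  have := leq_trans (hallE _) (subset_leq_card sI).
  rewrite cardsU1 !inE negb_or xA1 xA2 /= => leI leU.
  have := leq_add leI leU; rewrite addnCA [X in (_ <= X)%N]addnC cardsUI.
  rewrite addnC [X in (X + _)%N]addnC cardsUI leqNgt => /negP[].
  by rewrite addn1 ltnS leq_add.
have nb x : exists y, (x, y) \in E.
  have : (0 < #|nbhd E [set x]|)%N by rewrite (leq_trans _ (hallE _)) ?cards1.
  by case/card_gt0P => y /nbhdP[w /set1P->]; exists y.
have [f fE] := choice nb.
exists f; split=> // x1 x2 eqf; apply/eqP/negPn/negP => nex.
have := hallE [set x1; x2]; rewrite cards2 nex /= leqNgt => /negP[].
rewrite ltnS -(cards1 (f x1)); apply/subset_leq_card/fintype.subsetP => z.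
move=> /nbhdP[w + wz]; rewrite !inE => /orP[] /eqP xw; subst w.
  by apply/negPn/negP => ne; apply: uniqE; exists x1, z, (f x1).
rewrite eqf.
by apply/negPn/negP => ne; apply: uniqE; exists x2, z, (f x2).
Qed.

End Hall.

(** * A rank bound *)

(** Once [A] is ordered by [key], the product of the blocks [P] and [Q] is
    unitriangular, hence of rank [#|A|], while it factors through a space of
    dimension [#|C|]. *)
Lemma unitriangular_product_card (F : fieldType) (T T' : finType)
    (d : Order.disp_t) (K : orderType d) (key : T -> K)
    (P : T -> T' -> F) (Q : T' -> T -> F) (A : {set T}) (C : {set T'}) :
  (forall i i', i \in A -> i' \in A -> (key i <= key i')%O ->
     \sum_(j in C) P i j * Q j i' = (i == i')%:R) ->
  (#|A| <= #|C|)%N.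
Proof.
move=> triPQ.
pose PM := \matrix_(i < #|A|, j < #|C|) P (enum_val i) (enum_val j).
pose QM := \matrix_(j < #|C|, i < #|A|) Q (enum_val j) (enum_val i).
have PQ (i i' : 'I_#|A|) : (key (enum_val i) <= key (enum_val i'))%O ->
    (PM *m QM) i i' = (i == i')%:R.
  move=> lek; rewrite mxE -(inj_eq enum_val_inj) -triPQ ?enum_valP //.
  by rewrite [RHS]big_enum_val; apply: eq_bigr => j _; rewrite !mxE.
have free : row_free (PM *m QM).
  apply: inj_row_free => v vPQ; apply/eqP/negPn/negP => v0.
  have [i0 vi0] : exists i, v 0 i != 0.
    apply/existsP; apply: contraNT v0; rewrite negb_exists => /forallP v0.
    by apply/eqP/rowP => i; rewrite mxE; apply/eqP/negPn/v0.
  (* At an index of maximal key in the support of [v], the vector [v] and its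
     image have the same entry. *)
  case: (@Order.TotalTheory.arg_maxP _ _ _ i0 (fun i => v 0 i != 0)
    (fun i => key (enum_val i)) vi0) => m vm maxm.
  have := congr1 (fun w : 'rV_#|A| => w 0 m) vPQ; rewrite mxE [RHS]mxE.
  rewrite (bigD1 m) //= PQ // eqxx mulr1 big1 ?addr0 => [vm0|i im].
    by rewrite vm0 eqxx in vm.
  have [->|vi] := eqVneq (v 0 i) 0; first by rewrite mul0r.
  by rewrite PQ ?(negPf im) ?mulr0 //; apply: maxm.
rewrite -row_leq_rank -/(row_free _) in free *.
exact: leq_trans free (leq_trans (mxrankM_maxl _ _) (rank_leq_col _)).
Qed.

(** * Occurrences in a sequence *)

Section Occurrences.
Variables (T : eqType) (x0 : T).

(** An occurrence is numbered by how many precede it, so that the position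
    [i] of [s] becomes the copy number [count_mem x (take i s)]. *)
Lemma count_mem_take_lt (s : seq T) (i : nat) : (i < size s)%N ->
  (count_mem (nth x0 s i) (take i s) < count_mem (nth x0 s i) s)%N.
Proof.
move=> ltis; rewrite -{4}(cat_take_drop i s) count_cat.
by rewrite (drop_nth x0) //= eqxx add1n addnS ltnS leq_addr.
Qed.

Lemma occurrence_bij (s : seq T) (c : T -> nat) :
  (forall x, c x = count_mem x s) ->
  exists g : {x : T & 'I_(c x)} -> 'I_(size s),
    bijective g /\ forall x, nth x0 s (g x) = tag x.
Proof.
move=> /funext {c}->.
pose h (i : 'I_(size s)) : {x : T & 'I_(count_mem x s)} :=
  Tagged (fun x => 'I_(count_mem x s)) (Ordinal (count_mem_take_lt (ltn_ord i))).
have hinj : injective h.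
  suff hlt (i j : 'I_(size s)) : (i < j)%N -> h i <> h j.
    move=> i j hij; apply/val_inj => /=.
    by case: (ltngtP i j) => // [/hlt /(_ hij)|/hlt /(_ (esym hij))].
  move=> ltij hij.
  have eqx : nth x0 s i = nth x0 s j := congr1 tag hij.
  have : val (tagged (h i)) = val (tagged (h j)) by rewrite hij.
  rewrite /= -eqx => eqn.
  have := count_mem_take_lt (s := take j s) (i := i).
  rewrite size_takel; last exact: ltnW (ltn_ord j).
  by rewrite nth_take // take_takel ?(ltnW ltij) // eqn ltnn => /(_ ltij).
have hsurj y : exists i, h i = y.
  case: y => x [k ltk].
  have [i lti [eqx eqk]] : exists2 i, (i < size s)%N &
      nth x0 s i = x /\ count_mem x (take i s) = k.
    elim: s k ltk {h hinj} => // y s IHs k /=.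
    have [->|yx] := eqVneq y x.
      case: k => [_|k]; first by exists 0%N; rewrite //= take0.
      rewrite add1n ltnS => /IHs[i lti [eqx eqk]].
      by exists i.+1; rewrite //= eqxx eqk.
    rewrite add0n => /IHs[i lti [eqx eqk]].
    by exists i.+1; rewrite //= (negPf yx) eqk.
  exists (Ordinal lti); subst x k; rewrite /h /=.
  by congr (Tagged _ _); apply: val_inj.
have [g gK] := choice hsurj.
have hK : cancel h g by move=> i; apply: hinj; rewrite gK.
exists g; split; first by exists h.
by move=> y; rewrite -{2}(gK y).
Qed.

End Occurrences.

(** * Coefficient matrices of interleavings *)

Lemma linfun_linearE (F : fieldType) (U V : vectType F) (f : U -> V) :
  linear f -> forall x, linfun f x = f x.
Proof.
move=> lf x; pose fL := GRing.isLinear.Build F U V _ f lf.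
pose g : {linear U -> V} := HB.pack f fL.
exact: (lfunE g x).
Qed.

Section IntervalBases.
Variables (R : realType) (F : fieldType).

(** An isomorphism of [D] with the direct sum of the interval modules of [I],
    in coordinates with values in the field, so that no vector depends on the
    type of a fiber: [gen i a] is the image of the unit of the [i]-th summand,
    and vanishes where [I i] is not alive. *)
Record interval_basis (D : diagram R F) (T : finType) (I : T -> rinterval R) :=
  IntervalBasis {
    gen : T -> forall a, D a;
    crd : T -> forall a, D a -> F;
    crd_linear : forall i a, scalar (@crd i a);
    gen_map : forall i a b (h : a <= b),
      dmap D h (gen i a) = (a \in rset (I i))%:R *: gen i b;
    crd_gen : forall i j a,
      crd j (gen i a) = ((i == j) && (a \in rset (I i)))%:R;
    gen_crd : forall a (v : D a), v = \sum_i crd i v *: gen i a }.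

Arguments gen {D T I} b i a : rename.
Arguments crd {D T I} b i a v : rename.

Section BasisTheory.
Variables (D : diagram R F) (T : finType) (I : T -> rinterval R).
Variable b : interval_basis D I.

HB.instance Definition _ i a :=
  GRing.isLinear.Build F (D a) F^o _ (crd b i a : D a -> F^o)
    (@crd_linear _ _ _ b i a).

Lemma crd_sum i a (c : T -> F) :
  crd b i a (\sum_j c j *: gen b j a) = c i * (a \in rset (I i))%:R.
Proof.
rewrite linear_sum (bigD1 i) //= big1 ?addr0 => [|j ji]; rewrite linearZ /= crd_gen.
  by rewrite eqxx.
by rewrite (negPf ji) mulr0.
Qed.

Lemma crd_notin i a v : a \notin rset (I i) -> crd b i a v = 0.
Proof. by move=> aI; rewrite (gen_crd b v) crd_sum (negPf aI) mulr0. Qed.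

Lemma gen_notin i a : a \notin rset (I i) -> gen b i a = 0.
Proof.
move=> aI; rewrite (gen_crd b (gen b i a)) big1 // => j _.
by rewrite crd_gen (negPf aI) andbF scale0r.
Qed.

Lemma crd_map j a c (h : a <= c) v :
  crd b j c (dmap D h v) = (c \in rset (I j))%:R * crd b j a v.
Proof.
rewrite {1}(gen_crd b v) linear_sum /=.
under eq_bigr => i _ do rewrite linearZ /= gen_map scalerA.
rewrite crd_sum mulrC; congr (_ * _).
have [_|aI] := boolP (a \in _); first by rewrite mulr1.
by rewrite mulr0 crd_notin.
Qed.

Lemma gen_ext a (V : vectType F) (f g : 'Hom(D a, V)) :
  (forall i, a \in rset (I i) -> f (gen b i a) = g (gen b i a)) -> f = g.
Proof.
move=> fg; apply/lfunP => v; rewrite (gen_crd b v) !linear_sum.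
apply: eq_bigr => i _; rewrite !linearZ /=; congr (_ *: _).
by have [/fg//|/gen_notin->] := boolP (a \in rset (I i)); rewrite !linear0.
Qed.

Lemma crd_ext a (v w : D a) : (forall i, crd b i a v = crd b i a w) -> v = w.
Proof.
move=> vw; rewrite (gen_crd b v) (gen_crd b w).
by apply: eq_bigr => i _; rewrite vw.
Qed.

End BasisTheory.

(** The matrix of functions of a morphism into the [e]-shift.  Naturality
    compares the coefficients at [a] and [b] only when the source is alive at
    [a] and the target at [b + e]; the support condition makes the matrix
    unique. *)
Record mat_morphism (T T' : finType) (e : R) (I : T -> rinterval R)
    (J : T' -> rinterval R) (M : T -> T' -> R -> F) : Prop := MatMorphism {
  mat_supp : forall i j a, M i j a != 0 ->
    a \in rset (I i) /\ a + e \in rset (J j);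
  mat_natural : forall i j a b, a <= b ->
    (a \in rset (I i))%:R * M i j b = (b + e \in rset (J j))%:R * M i j a }.

Definition mat_composite (T T' : finType) (e : R) (I : T -> rinterval R)
    (M : T -> T' -> R -> F) (N : T' -> T -> R -> F) : Prop :=
  forall i i' a, \sum_j M i j a * N j i' (a + e) =
    [&& i == i', a \in rset (I i) & a + e + e \in rset (I i)]%:R.

Definition mat_interleaved (T T' : finType) (e : R) (I : T -> rinterval R)
    (J : T' -> rinterval R) : Prop :=
  exists M N, [/\ mat_morphism e I J M, mat_morphism e J I N,
    mat_composite e I M N & mat_composite e J N M].

Section MatrixOfTransformation.
Variables (D D' : diagram R F) (T T' : finType).
Variables (I : T -> rinterval R) (J : T' -> rinterval R).
Variables (b : interval_basis D I) (b' : interval_basis D' J) (e : R).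

Definition nt_mat (phi : nat_trans D (Defs.shift D' e)) i j a : F :=
  crd b' j (a + e) (phi a (gen b i a)).

Lemma nt_mat_gen (phi : nat_trans D (Defs.shift D' e)) i a :
  phi a (gen b i a) = \sum_j nt_mat phi i j a *: gen b' j (a + e).
Proof. exact: (gen_crd b'). Qed.

Lemma nt_mat_morphism phi : mat_morphism e I J (nt_mat phi).
Proof.
split=> [i j a|i j a c ac].
  move=> phi0; split; apply: contraNT phi0 => notin; rewrite /nt_mat.
    by rewrite gen_notin // linear0 linear0.
  by rewrite crd_notin.
have /lfunP/(_ (gen b i a)) := nt_natural phi ac.
rewrite !comp_lfunE gen_map linearZ /= => /(congr1 (crd b' j (c + e))).
by rewrite linearZ /= => ->; rewrite crd_map.
Qed.

Section FromMatrix.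
Variable M : T -> T' -> R -> F.
Hypothesis morM : mat_morphism e I J M.

Definition mat_fun a (v : D a) : Defs.shift D' e a :=
  \sum_j (\sum_i crd b i a v * M i j a) *: gen b' j (a + e).

Lemma mat_fun_linear a : linear (@mat_fun a).
Proof.
move=> k u v; rewrite /mat_fun scaler_sumr -big_split; apply: eq_bigr => j _ /=.
rewrite scalerA -scalerDl mulr_sumr -big_split; congr (_ *: _).
by apply: eq_bigr => i _ /=; rewrite linearP mulrDl mulrA.
Qed.

Definition mat_hom a : 'Hom(D a, Defs.shift D' e a) := linfun (@mat_fun a).

Lemma crd_mat_hom_gen i j a : crd b' j (a + e) (mat_hom a (gen b i a)) = M i j a.
Proof.
rewrite (linfun_linearE (@mat_fun_linear a)) crd_sum (bigD1 i) //= big1 => [|k ki].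
  rewrite addr0 crd_gen eqxx /=.
  have [->|/(mat_supp morM)[-> ->]] := eqVneq (M i j a) 0; first by rewrite mulr0 mul0r.
  by rewrite mulr1 mul1r.
by rewrite crd_gen eq_sym (negPf ki) mul0r.
Qed.

Lemma mat_hom_natural a c (h : a <= c) :
  (mat_hom c \o dmap D h)%VF = (dmap (Defs.shift D' e) h \o mat_hom a)%VF.
Proof.
apply: (gen_ext (b := b)) => i _; apply: (crd_ext (b := b')) => j.
rewrite !comp_lfunE gen_map linearZ /= linearZ /= crd_mat_hom_gen.
by rewrite crd_map crd_mat_hom_gen -(mat_natural morM).
Qed.

Definition mat_nt : nat_trans D (Defs.shift D' e) := NatTrans mat_hom_natural.

Lemma nt_mat_nt i j a : nt_mat mat_nt i j a = M i j a.
Proof. exact: crd_mat_hom_gen. Qed.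
End FromMatrix.
End MatrixOfTransformation.

Lemma nt_mat_composite (D D' : diagram R F) (T T' : finType)
    (I : T -> rinterval R) (J : T' -> rinterval R)
    (b : interval_basis D I) (b' : interval_basis D' J) (e : R) (he : 0 <= e)
    (phi : nat_trans D (Defs.shift D' e)) (psi : nat_trans D' (Defs.shift D e)) :
  (forall a, (psi (a + e) \o phi a)%VF = dmap D (le_shift2 he a)) <->
  mat_composite e I (nt_mat b b' phi) (nt_mat b' b psi).
Proof.
have key i i' a :
    crd b i' (a + e + e) ((psi (a + e) \o phi a)%VF (gen b i a)) =
    \sum_j nt_mat b b' phi i j a * nt_mat b' b psi j i' (a + e).
  rewrite comp_lfunE (nt_mat_gen b b') !linear_sum; apply: eq_bigr => j _.
  by rewrite linearZ /= linearZ.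
have keyD i i' a :
    crd b i' (a + e + e) (dmap D (le_shift2 he a) (gen b i a)) =
    [&& i == i', a \in rset (I i) & a + e + e \in rset (I i)]%:R.
  rewrite crd_map crd_gen -natrM mulnb [RHS]/=.
  by have [->|//] := eqVneq i i'; rewrite ?andbF // andbC.
split=> [comp i i' a|comp a].
  by rewrite -key comp keyD.
apply: (gen_ext (b := b)) => i _; apply: (crd_ext (b := b)) => i'.
by rewrite key comp keyD.
Qed.

(** Reduces interleavings of interval decomposable modules to a statement about
    matrices that mentions the modules only through their intervals. *)
Lemma interleavedP (D D' : diagram R F) (T T' : finType)
    (I : T -> rinterval R) (J : T' -> rinterval R)
    (b : interval_basis D I) (b' : interval_basis D' J) (e : R) :
  interleaved e D D' <-> 0 <= e /\ mat_interleaved e I J.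
Proof.
split=> [[he [phi [psi [c1 c2]]]]|[he [M [N [mM mN c1 c2]]]]].
  split=> //; exists (nt_mat b b' phi), (nt_mat b' b psi).
  split; try exact: nt_mat_morphism.
    exact/(nt_mat_composite b b' he).
  exact/(nt_mat_composite b' b he).
have eM : nt_mat b b' (mat_nt b b' mM) = M.
  by do 3!apply: funext => ?; apply: nt_mat_nt.
have eN : nt_mat b' b (mat_nt b' b mN) = N.
  by do 3!apply: funext => ?; apply: nt_mat_nt.
exists he, (mat_nt b b' mM), (mat_nt b' b mN); split.
  by apply/(nt_mat_composite b b' he); rewrite eM eN.
by apply/(nt_mat_composite b' b he); rewrite eM eN.
Qed.

Definition fiber_gen (p : bool) : fiber F p :=
  if p as p0 return fiber F p0 then (1 : F^o) else 0.

Definition fiber_crd (p : bool) : fiber F p -> F :=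
  if p as p0 return (fiber F p0 -> F) then (fun v : F^o => v) else (fun=> 0).

Lemma fiber_crd_linear p : scalar (@fiber_crd p).
Proof. by case: p => k u v //=; rewrite mulr0 addr0. Qed.

Lemma fiber_crd0 p : @fiber_crd p 0 = 0. Proof. by case: p. Qed.

Lemma fiber_gen_map p q : fiber_map F p q (fiber_gen p) = p%:R *: fiber_gen q.
Proof.
case: p q => [] []; rewrite /= ?id_lfunE ?zero_lfunE ?scale1r ?scale0r //.
Qed.

Lemma fiber_crd_gen p : fiber_crd (fiber_gen p) = p%:R. Proof. by case: p. Qed.

Lemma fiber_gen_crd p (v : fiber F p) : v = fiber_crd v *: fiber_gen p.
Proof.
case: p v => [v|v]; first by rewrite /= [RHS]mulr1.
by apply/rowP => -[].
Qed.

Lemma chi_itv_basis (I : rinterval R) :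
  interval_basis (chi_itv F I) (fun _ : unit => I).
Proof.
exists (fun _ a => fiber_gen (a \in rset I)) (fun _ a v => fiber_crd v).
- by move=> _ a; apply: fiber_crd_linear.
- by move=> _ a c h; apply: fiber_gen_map.
- by move=> [] [] a; apply: fiber_crd_gen.
- by move=> a v; rewrite (big_pred1 tt) => [|[]] //; apply: fiber_gen_crd.
Qed.

Notation chi_seq s := (big_dsum [seq chi_itv F J | J <- s]).

(** Positions range over all of [nat], with the empty interval beyond the end
    of [s]: a barcode padded with empty intervals then has the same module. *)
Fixpoint seq_gen (s : seq (rinterval R)) (i : nat) (a : R) : chi_seq s a :=
  match s, i with
  | [::], _ => 0
  | J :: s', 0%N => (fiber_gen (a \in rset J), 0)
  | J :: s', i'.+1 => (0, seq_gen s' i' a)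
  end.

Fixpoint seq_crd (s : seq (rinterval R)) (i : nat) (a : R) :
    chi_seq s a -> F :=
  match s, i with
  | [::], _ => fun=> 0
  | J :: s', 0%N => fun v => fiber_crd v.1
  | J :: s', i'.+1 => fun v => seq_crd i' v.2
  end.

Notation itv_at s := (fun i : nat => nth (itv_empty R) s i).

Lemma in_itv_empty (a : R) : (a \in rset (itv_empty R)) = false.
Proof. exact: in_set0. Qed.

Lemma seq_crd_linear s i a : scalar (@seq_crd s i a).
Proof.
elim: s i => [|J s IHs] [|i] k u v /=; rewrite ?mulr0 ?addr0 //.
  exact: fiber_crd_linear.
exact: IHs.
Qed.

Lemma seq_crd0 s i a : @seq_crd s i a 0 = 0.
Proof. by elim: s i => [|J s IHs] [|i] //=; apply: fiber_crd0. Qed.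

Lemma seq_gen_map s i a c (h : a <= c) :
  dmap (chi_seq s) h (seq_gen s i a) =
    (a \in rset (itv_at s i))%:R *: seq_gen s i c.
Proof.
elim: s i => [|J s IHs] [|i] /=; rewrite ?dzero ?linear0 ?scaler0 //.
  rewrite (@dsum_mapE R F (chi_itv F J) (chi_seq s) a c h (fiber_gen (a \in rset J), 0)).
  rewrite /= fiber_gen_map linear0; congr (_, _).
  by rewrite scaler0.
rewrite (@dsum_mapE R F (chi_itv F J) (chi_seq s) a c h (0, seq_gen s i a)).
by rewrite /= linear0 IHs; congr (_, _); rewrite scaler0.
Qed.

Lemma seq_crd_gen s i j a :
  seq_crd j (seq_gen s i a) = ((i == j) && (a \in rset (itv_at s i)))%:R.
Proof.
elim: s i j => [|J s IHs] [|i] [|j] /=;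
  rewrite ?nth_nil ?in_itv_empty ?andbF //.
- exact: fiber_crd_gen.
- exact: seq_crd0.
- exact: fiber_crd0.
- exact: IHs.
Qed.

Lemma seq_gen_crd s n a (v : chi_seq s a) : (size s <= n)%N ->
  v = \sum_(i < n) seq_crd i v *: seq_gen s i a.
Proof.
elim: s n v => [|J s IHs] n v /=; first by move=> _; apply/rowP => -[].
case: n => // n; rewrite ltnS => /IHs IHn.
rewrite big_ord_recl /=; case: v => [v1 v2] /=.
have -> : \sum_(i < n) seq_crd (bump 0 i) ((v1, v2) : chi_seq (J :: s) a) *:
    seq_gen (J :: s) (bump 0 i) a = (0, v2) :> chi_seq (J :: s) a.
  rewrite {2}(IHn v2) /=.
  elim/big_rec2: _ => [//|i x y _ ->]; congr (_, _).
  by rewrite addr0 -[LHS]/(_ *: 0) scaler0.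
congr (_, _); first by rewrite addr0; apply: fiber_gen_crd.
by rewrite -[RHS]/(_ *: 0 + v2) scaler0 add0r.
Qed.

Lemma chi_seq_basis (s : seq (rinterval R)) n (sn : (size s <= n)%N) :
  interval_basis (chi_seq s) (fun i : 'I_n => itv_at s i).
Proof.
exists (fun (i : 'I_n) a => seq_gen s i a) (fun (i : 'I_n) a v => seq_crd i v).
- by move=> i a; apply: seq_crd_linear.
- by move=> i a c h; apply: seq_gen_map.
- by move=> i j a; apply: seq_crd_gen.
- by move=> a v; apply: seq_gen_crd.
Qed.

End IntervalBases.

(** * Shifts and closeness of intervals *)

Section Closeness.
Variable R : realType.
Implicit Types (I J K : rinterval R) (e : R).

Lemma rset_between I (a b c : R) : a \in rset I -> c \in rset I ->
  a <= b -> b <= c -> b \in rset I.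
Proof.
by rewrite !inE => aI cI ab bc; apply: (rsetP aI cI); rewrite ab bc.
Qed.

(** The left end of [J] is at most [e] to the right of that of [I], expressed
    by points so as to cover open, closed and infinite ends alike; dually for
    [upper_shift] and right ends.  A nonzero morphism from [I] to the
    [e]-shift of [J] gives [lower_shift e I J] and [upper_shift e J I]. *)
Definition lower_shift e I J : Prop :=
  forall a, a \in rset I -> exists2 b, b \in rset J & b <= a + e.

Definition upper_shift e I J : Prop :=
  forall a, a \in rset I -> exists2 b, b \in rset J & a - e <= b.

Definition close e I J : Prop :=
  [/\ lower_shift e I J, lower_shift e J I, upper_shift e I J
    & upper_shift e J I].

(** The transition maps of [I] over a length of [2 e] vanish, that is, [I] is
    [e]-interleaved with the empty interval. *)
Definition negligible e I : Prop :=
  forall a, a \in rset I -> a + e + e \notin rset I.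

Definition matchable e I J : Prop :=
  close e I J \/ negligible e I /\ negligible e J.

Lemma matchable_sym e I J : matchable e I J -> matchable e J I.
Proof. by case=> [[]|[]]; [left|right]. Qed.

Lemma not_lower_shift e I J : ~ lower_shift e I J ->
  exists2 a, a \in rset I & forall b, b \in rset J -> a + e < b.
Proof.
move=> /existsNP[a /not_implyP[aI nb]]; exists a => // b bJ.
by rewrite ltNge; apply/negP => ba; apply: nb; exists b.
Qed.

Lemma not_upper_shift e I J : ~ upper_shift e I J ->
  exists2 a, a \in rset I & forall b, b \in rset J -> b < a - e.
Proof.
move=> /existsNP[a /not_implyP[aI nb]]; exists a => // b bJ.
by rewrite ltNge; apply/negP => ba; apply: nb; exists b.
Qed.

Lemma lower_shift_le e e' I J : e <= e' ->
  lower_shift e I J -> lower_shift e' I J.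
Proof.
by move=> ee' IJ a /IJ[b bJ ba]; exists b => //; rewrite (le_trans ba) ?lerD2l.
Qed.

Lemma upper_shift_le e e' I J : e <= e' ->
  upper_shift e I J -> upper_shift e' I J.
Proof.
move=> ee' IJ a /IJ[b bJ ba]; exists b => //.
by rewrite (le_trans _ ba) // lerD2l lerN2.
Qed.

Definition bounded_below I : bool := `[< has_lbound (rset I) >].
Definition bounded_above I : bool := `[< has_ubound (rset I) >].

Lemma bounded_belowP I (y : R) : (forall x, x \in rset I -> y <= x) ->
  bounded_below I.
Proof. by move=> yI; apply/asboolP; exists y => x xI; apply: yI; rewrite inE. Qed.

Lemma bounded_aboveP I (y : R) : (forall x, x \in rset I -> x <= y) ->
  bounded_above I.
Proof. by move=> yI; apply/asboolP; exists y => x xI; apply: yI; rewrite inE. Qed.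

Lemma inf_le_mem I x : bounded_below I -> x \in rset I -> inf (rset I) <= x.
Proof. by move=> /asboolP bI; rewrite inE => xI; apply: ge_inf. Qed.

Lemma mem_le_sup I x : bounded_above I -> x \in rset I -> x <= sup (rset I).
Proof. by move=> /asboolP bI; rewrite inE => xI; apply: ub_le_sup. Qed.

Lemma le_inf_itv I x0 (y : R) : x0 \in rset I ->
  (forall x, x \in rset I -> y <= x) -> y <= inf (rset I).
Proof.
rewrite inE => x0I yI; apply: lb_le_inf; first by exists x0.
by move=> x xI; apply: yI; rewrite inE.
Qed.

Lemma sup_itv_le I x0 (y : R) : x0 \in rset I ->
  (forall x, x \in rset I -> x <= y) -> sup (rset I) <= y.
Proof.
rewrite inE => x0I yI; apply: ge_sup; first by exists x0.
by move=> x xI; apply: yI; rewrite inE.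
Qed.

Lemma inf_unbounded I : ~~ bounded_below I -> inf (rset I) = 0.
Proof. by move=> /asboolPn bI; apply: inf_out => -[]. Qed.

Lemma sup_unbounded I : ~~ bounded_above I -> sup (rset I) = 0.
Proof. by move=> /asboolPn bI; apply: sup_out => -[]. Qed.

Lemma lower_shift_bounded e I J :
  lower_shift e I J -> bounded_below J -> bounded_below I.
Proof.
move=> IJ bJ; apply: (@bounded_belowP _ (inf (rset J) - e)) => x /IJ[y yJ yx].
by have := inf_le_mem bJ yJ; lra.
Qed.

Lemma upper_shift_bounded e I J :
  upper_shift e I J -> bounded_above J -> bounded_above I.
Proof.
move=> IJ bJ; apply: (@bounded_aboveP _ (sup (rset J) + e)) => x /IJ[y yJ yx].
by have := mem_le_sup bJ yJ; lra.
Qed.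

Lemma lower_shift_inf e I J x0 : x0 \in rset I ->
  lower_shift e I J -> bounded_below J -> inf (rset J) <= inf (rset I) + e.
Proof.
move=> x0I IJ bJ; rewrite -lerBlDr; apply: le_inf_itv x0I _ => x /IJ[y yJ yx].
by have := inf_le_mem bJ yJ; lra.
Qed.

Lemma upper_shift_sup e I J x0 : x0 \in rset I ->
  upper_shift e I J -> bounded_above J -> sup (rset I) <= sup (rset J) + e.
Proof.
move=> x0I IJ bJ; apply: sup_itv_le x0I _ => x /IJ[y yJ yx].
by have := mem_le_sup bJ yJ; lra.
Qed.

Lemma not_lower_shift_inf e I J y0 : y0 \in rset J -> ~ lower_shift e I J ->
  bounded_below J /\ (bounded_below I -> inf (rset I) + e <= inf (rset J)).
Proof.
move=> y0J /not_lower_shift[a aI aJ]; split=> [|bI].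
  by apply: (@bounded_belowP _ (a + e)) => x /aJ/ltW.
apply: le_inf_itv y0J _ => x /aJ; have := inf_le_mem bI aI; lra.
Qed.

Lemma not_upper_shift_sup e I J y0 : y0 \in rset J -> ~ upper_shift e I J ->
  bounded_above J /\ (bounded_above I -> sup (rset J) + e <= sup (rset I)).
Proof.
move=> y0J /not_upper_shift[a aI aJ]; split=> [|bI].
  by apply: (@bounded_aboveP _ (a - e)) => x /aJ/ltW.
rewrite -lerBrDr; apply: sup_itv_le y0J _ => x /aJ.
by have := mem_le_sup bI aI; lra.
Qed.

(** Along a chain of nonzero morphisms an infinite left end stays infinite and
    a finite right end stays finite, so the first component decreases weakly.
    When it does not change, the two ends have the same types throughout the
    chain, and the sum of the finite ends, an infinite one counting as [0], can
    be compared. *)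
Definition itv_key I : (nat *l R)%type :=
  ((bounded_below I + ~~ bounded_above I)%N, inf (rset I) + sup (rset I)).

Section Chain.
Variables (e : R) (I J K : rinterval R).
Hypotheses (lIJ : lower_shift e I J) (uJI : upper_shift e J I).
Hypotheses (lJK : lower_shift e J K) (uKJ : upper_shift e K J).
Hypothesis (key_le : (itv_key I <= itv_key K)%O).

Lemma chain_same_type :
  [/\ bounded_below J = bounded_below I, bounded_below K = bounded_below I,
    bounded_above J = bounded_above I, bounded_above K = bounded_above I &
    inf (rset I) + sup (rset I) <= inf (rset K) + sup (rset K)].
Proof.
have b1 := lower_shift_bounded lIJ; have b2 := lower_shift_bounded lJK.
have a1 := upper_shift_bounded uJI; have a2 := upper_shift_bounded uKJ.
move: key_le; rewrite /itv_key lexi_pair leEnat.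
move: b1 b2 a1 a2.
case: (bounded_below I) (bounded_below J) (bounded_below K)
  (bounded_above I) (bounded_above J) (bounded_above K) =>
  [] [] [] [] [] [] //= b1 b2 a1 a2;
  first [by move=> ?; split|by move: (b1 isT)|by move: (b2 isT)|by move: (a1 isT)|
    by move: (a2 isT)].
Qed.

(** If [J] is close to neither [I] nor [K], one of its ends is more than [e']
    away from that of [I] and one from that of [K].  As morphisms move ends in
    one direction by at most [e], each of the four combinations forces the
    endpoint sum to decrease strictly from [I] to [K]. *)
Lemma close_to_end e' x y z : e < e' ->
  x \in rset I -> y \in rset J -> z \in rset K ->
  close e' I J \/ close e' K J.
Proof.
move=> ltee xI yJ zK; have leee := ltW ltee.
have [bJ bK aJ aK lek] := chain_same_type.
have i1 := lower_shift_inf xI lIJ; have i2 := lower_shift_inf yJ lJK.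
have s1 := upper_shift_sup yJ uJI; have s2 := upper_shift_sup zK uKJ.
have [|nIJ] := pselect (close e' I J); first by left.
have [|nKJ] := pselect (close e' K J); first by right.
have fI : ~ lower_shift e' J I \/ ~ upper_shift e' I J.
  apply/not_andP => -[l u]; apply: nIJ.
  by split=> //; [apply: lower_shift_le lIJ|apply: upper_shift_le uJI].
have fK : ~ lower_shift e' K J \/ ~ upper_shift e' J K.
  apply/not_andP => -[l u]; apply: nKJ.
  by split=> //; [apply: lower_shift_le lJK|apply: upper_shift_le uKJ].
have infI := @inf_unbounded I; have infJ := @inf_unbounded J.
have infK := @inf_unbounded K; have supI := @sup_unbounded I.
have supJ := @sup_unbounded J; have supK := @sup_unbounded K.
rewrite ?bJ ?bK ?aJ ?aK in i1 i2 s1 s2 infJ infK supJ supK.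
have {}fI : bounded_below I /\ inf (rset J) + e' <= inf (rset I) \/
    bounded_above I /\ sup (rset J) + e' <= sup (rset I).
  case: fI => [/(not_lower_shift_inf xI)[b h]|/(not_upper_shift_sup yJ)[b h]].
    by left; split=> //; apply: h; rewrite bJ.
  by right; rewrite -aJ; split=> //; apply: h; rewrite -aJ.
have {}fK : bounded_below I /\ inf (rset K) + e' <= inf (rset J) \/
    bounded_above I /\ sup (rset K) + e' <= sup (rset J).
  case: fK => [/(not_lower_shift_inf yJ)[b h]|/(not_upper_shift_sup zK)[b h]].
    by left; rewrite -bJ; split=> //; apply: h; rewrite bK -bJ.
  by right; rewrite -aK; split=> //; apply: h; rewrite aJ -aK.
(* With the types of both ends fixed, what remains is linear arithmetic on the
   ends; the end of an unbounded side is [0] for all three intervals. *)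
exfalso; case: (bounded_below I) (bounded_above I)
    i1 i2 s1 s2 infI infJ infK supI supJ supK fI fK => [] [] /=
    i1 i2 s1 s2 infI infJ infK supI supJ supK fI fK;
  repeat match goal with H : is_true true -> _ |- _ => specialize (H isT) end;
  case: fI => -[bI fI]; case: fK => -[bK' fK]; try done; lra.
Qed.

(** The scalar identity between composites can be read off only at a parameter
    where source and target are both alive.  If there were none, [K] would end
    before [I] starts, up to [2 e], and as both last longer than [2 e] this
    contradicts the order of their endpoint sums. *)
Lemma composite_nonzero e' : e < e' ->
  ~ negligible e' I -> ~ negligible e' K ->
  exists2 a, a \in rset I & a + e + e \in rset K.
Proof.
move=> ltee /existsNP[x /not_implyP[xI /negP/negPn x'I]].
move=> /existsNP[z /not_implyP[zK /negP/negPn z'K]].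
apply: contrapT => none.
have sep u v : u \in rset I -> v \in rset K -> v <= u + e + e.
  move=> uI vK; rewrite leNgt; apply/negP => lt; apply: none; exists u => //.
  have [w wJ wu] := lIJ uI; have [w' w'K w'w] := lJK wJ.
  by apply: (rset_between w'K vK); lra.
have [bJ bK aJ aK lek] := chain_same_type.
have bI : bounded_below I.
  apply: (@bounded_belowP _ (z + e' + e' - e - e)) => u uI.
  by have := sep _ _ uI z'K; lra.
have uK : bounded_above K.
  by apply: (@bounded_aboveP _ (x + e + e)) => v vK; apply: sep.
have uI : bounded_above I by rewrite -aK.
have := inf_le_mem (I := K) (x := z); rewrite bK => /(_ bI zK).
have := mem_le_sup uI x'I.
have : z + e' + e' - e - e <= inf (rset I).
  by apply: le_inf_itv xI _ => u uI'; have := sep _ _ uI' z'K; lra.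
have : sup (rset K) <= x + e + e.
  by apply: sup_itv_le zK _ => v vK; apply: sep.
move: lek ltee; lra.
Qed.
End Chain.
End Closeness.

(** * Interleavings and matchings *)

Section Matchings.
Variables (R : realType) (F : fieldType).

Lemma mat_interleaved_sym (T T' : finType) (e : R) (I : T -> rinterval R)
    (J : T' -> rinterval R) :
  mat_interleaved F e I J -> mat_interleaved F e J I.
Proof. by case=> M [N [? ? ? ?]]; exists N, M. Qed.

(** The morphism composed with the transition map of the target from the
    [e]-shift to the [e']-shift: coefficients persist as long as the target is
    alive. *)
Definition mat_push (T T' : finType) (e' : R) (J : T' -> rinterval R)
    (M : T -> T' -> R -> F) i j a : F :=
  M i j a * (a + e' \in rset (J j))%:R.

Lemma mat_push_morphism (T T' : finType) (e e' : R) (I : T -> rinterval R)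
    (J : T' -> rinterval R) (M : T -> T' -> R -> F) :
  e <= e' -> mat_morphism e I J M -> mat_morphism e' I J (mat_push e' J M).
Proof.
move=> lee mM; split=> [i j a|i j a b ab]; rewrite /mat_push.
  case: (boolP (_ \in rset (J j))) => [aJ|_]; last by rewrite mulr0 eqxx.
  by rewrite mulr1 => /(mat_supp mM)[].
case: (boolP (b + e' \in _)) => [bJ|_]; last by rewrite mulr0 mulr0 mul0r.
rewrite mulr1 (mat_natural mM) // mul1r.
have [->|/(mat_supp mM)[_ aJ]] := eqVneq (M i j a) 0; first by rewrite mulr0 mul0r.
have aJ' : a + e' \in rset (J j) by apply: (rset_between aJ bJ); lra.
have bJ' : b + e \in rset (J j) by apply: (rset_between aJ bJ); lra.
by rewrite aJ' bJ' mulr1 mul1r.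
Qed.

(** An intermediate interval that dies before the larger shift is reached
    contributes to neither sum unless the final interval is dead as well, so
    the sums agree term by term when the final interval is alive. *)
Lemma mat_push_composite (T T' : finType) (e e' : R) (I : T -> rinterval R)
    (J : T' -> rinterval R) (M : T -> T' -> R -> F) (N : T' -> T -> R -> F) :
  0 <= e -> e <= e' -> mat_morphism e I J M -> mat_morphism e J I N ->
  mat_composite e I M N ->
  mat_composite e' I (mat_push e' J M) (mat_push e' I N).
Proof.
move=> e_ge0 lee mM mN comp i i' a.
have [aI'|aI'] := boolP (a + e' + e' \in rset (I i')); last first.
  rewrite big1 => [|j _]; last by rewrite /mat_push (negPf aI') mulr0 mulr0.
  by have [->|//] := eqVneq i i'; rewrite (negPf aI') andbF.
rewrite [LHS](_ : _ = \sum_j M i j a * N j i' (a + e)); last first.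
  apply: eq_bigr => j _; rewrite /mat_push aI' mulr1.
  have [->|/(mat_supp mM)[_ aJ]] := eqVneq (M i j a) 0; first by rewrite !mul0r.
  have := mat_natural mN j i' (a := a + e) (b := a + e').
  rewrite lerD2l lee aJ mul1r => /(_ isT) eN.
  have [N0|N0] := eqVneq (N j i' (a + e)) 0.
    by rewrite eN N0 !mulr0.
  have [_ aI] := mat_supp mN N0.
  move: eN; rewrite (rset_between aI aI') ?mul1r; [move=> eN|lra|lra].
  have /(mat_supp mN)[aJ' _] : N j i' (a + e') != 0 by rewrite eN.
  by rewrite eN aJ' mulr1.
rewrite comp; have [ii'|//] := eqVneq i i'; subst i'; rewrite aI' andbT.
case: (boolP (a \in _)) => //= aI.
by rewrite (rset_between aI aI') //; lra.
Qed.

Lemma mat_interleaved_le (T T' : finType) (e e' : R) (I : T -> rinterval R)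
    (J : T' -> rinterval R) :
  0 <= e -> e <= e' -> mat_interleaved F e I J -> mat_interleaved F e' I J.
Proof.
move=> e_ge0 lee [M [N [mM mN c1 c2]]].
exists (mat_push e' J M), (mat_push e' I N).
by split; [exact: mat_push_morphism mM|exact: mat_push_morphism mN|
  exact: mat_push_composite c1|exact: mat_push_composite c2].
Qed.

Lemma bijection_interleaved (T T' : finType) (e : R) (I : T -> rinterval R)
    (J : T' -> rinterval R) (h : T -> T') : bijective h ->
  (forall i, mat_interleaved F e (fun _ : unit => I i) (fun _ : unit => J (h i))) ->
  mat_interleaved F e I J.
Proof.
move=> [h' hK h'K] /choice[M /choice[N MN]].
pose M' i j a := (h i == j)%:R * M i tt tt a.
pose N' j i a := (h i == j)%:R * N i tt tt a.
have composite (i i' : T) a : \sum_j M' i j a * N' j i' (a + e) =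
    [&& i == i', a \in rset (I i) & a + e + e \in rset (I i)]%:R.
  rewrite (bigD1 (h i)) //= big1 => [|j ji]; last first.
    by rewrite /M' eq_sym (negPf ji) !mul0r.
  rewrite /M' /N' eqxx mul1r addr0 (can_eq hK) [i' == i]eq_sym.
  have [->|_] := eqVneq i i'; last by rewrite mul0r mulr0.
  have [_ _ /(_ tt tt a)] := MN i'; rewrite (big_pred1 tt) => [|[]] //.
  by rewrite !mul1r => ->.
exists M', N'; split=> //.
- split=> [i j a|i j a b ab]; rewrite /M'; have [mM _ _ _] := MN i;
    have [<-|_] := eqVneq (h i) j; rewrite ?mul0r ?eqxx ?mulr0 // !mul1r.
    exact: (mat_supp mM).
  exact: (mat_natural mM).
- split=> [j i a|j i a b ab]; rewrite /N'; have [_ mN _ _] := MN i;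
    have [<-|_] := eqVneq (h i) j; rewrite ?mul0r ?eqxx ?mulr0 // !mul1r.
    exact: (mat_supp mN).
  exact: (mat_natural mN).
- move=> j j' a; rewrite (bigD1 (h' j)) //= big1 => [|i ij]; last first.
    rewrite /N'; have [eh|_] := eqVneq (h i) j; last by rewrite !mul0r.
    by rewrite -eh hK eqxx in ij.
  rewrite /M' /N' h'K eqxx mul1r addr0.
  have [_|_] := eqVneq j j'; last by rewrite mul0r mulr0.
  have [_ _ _ /(_ tt tt a)] := MN (h' j).
  by rewrite (big_pred1 tt) => [|[]] //; rewrite h'K !mul1r => ->.
Qed.

Section Pair.
Variables (e : R) (I J : rinterval R).
Hypothesis e_ge0 : 0 <= e.

Definition unit_mat (X Y : rinterval R) (_ _ : unit) a : F :=
  ((a \in rset X) && (a + e \in rset Y))%:R.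

Lemma unit_mat_morphism (X Y : rinterval R) :
  lower_shift e X Y -> upper_shift e Y X ->
  mat_morphism e (fun _ : unit => X) (fun _ : unit => Y) (unit_mat X Y).
Proof.
move=> lXY uYX; split=> [i j a|i j a b ab].
  by rewrite /unit_mat; case: andP => //; rewrite eqxx.
rewrite /unit_mat -!natrM !mulnb; congr (_%:R); congr nat_of_bool.
have [aX|aX] := boolP (a \in rset X); last by rewrite andbF.
have [bY|bY] := boolP (b + e \in rset Y); last by rewrite andbF.
rewrite /= andbT.
have [x xX bx] := uYX _ bY; have [y yY ya] := lXY _ aX.
by rewrite (rset_between aX xX) ?(rset_between yY bY) //; lra.
Qed.

Lemma unit_mat_composite (X Y : rinterval R) :
  lower_shift e X Y -> upper_shift e X Y ->
  mat_composite e (fun _ : unit => X) (unit_mat X Y) (unit_mat Y X).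
Proof.
move=> lXY uXY [] [] a; rewrite (big_pred1 tt) => [|[]] //=.
rewrite /unit_mat -natrM mulnb; congr (_%:R); congr nat_of_bool.
have [aX|//] := boolP (a \in rset X).
have [aX'|] := boolP (a + e + e \in rset X); last by rewrite !andbF.
have [y yY ay] := lXY _ aX; have [y' y'Y ay'] := uXY _ aX'.
by rewrite (rset_between yY y'Y) //; lra.
Qed.

Lemma zero_mat_morphism (X Y : rinterval R) :
  mat_morphism e (fun _ : unit => X) (fun _ : unit => Y) (fun _ _ _ => 0 : F).
Proof. by split=> [i j a|i j a b ab]; rewrite ?eqxx // !mulr0. Qed.

Lemma zero_mat_composite (X : rinterval R) : negligible e X ->
  mat_composite e (fun _ : unit => X) (fun (_ _ : unit) _ => 0 : F)
    (fun (_ _ : unit) _ => 0 : F).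
Proof.
move=> nX [] [] a; rewrite big1 => [|j _]; last by rewrite mulr0.
by rewrite /=; have [/nX/negPf->|//] := boolP (a \in rset X).
Qed.

Lemma matchable_interleaved : matchable e I J ->
  interleaved e (chi_itv F I) (chi_itv F J).
Proof.
move=> mIJ; apply/(interleavedP (chi_itv_basis F I) (chi_itv_basis F J)).
split=> //; case: mIJ => [[lIJ lJI uIJ uJI]|[nI nJ]].
  exists (unit_mat I J), (unit_mat J I); split.
  - exact: unit_mat_morphism.
  - exact: unit_mat_morphism.
  - exact: unit_mat_composite.
  - exact: unit_mat_composite.
by exists (fun _ _ _ => 0), (fun _ _ _ => 0); split;
  [exact: zero_mat_morphism|exact: zero_mat_morphism
  |exact: zero_mat_composite|exact: zero_mat_composite].
Qed.
End Pair.

(** A morphism of interval modules from [I] to the [e]-shift of [J] that is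
    nonzero at [d]: the last two clauses are what naturality forces before and
    after [d]. *)
Definition overlap (e : R) (I J : rinterval R) (d : R) : Prop :=
  [/\ d \in rset I, d + e \in rset J,
    forall c, c <= d -> c \in rset I -> c + e \in rset J &
    forall c, d <= c -> c + e \in rset J -> c \in rset I].

Lemma overlap_lower e I J d : overlap e I J d -> lower_shift e I J.
Proof.
case=> dI dJ low up a aI; have [ad|/ltW da] := leP a d.
  by exists (a + e); first exact: low.
by exists (d + e); rewrite ?lerD2r.
Qed.

Lemma overlap_upper e I J d : overlap e I J d -> upper_shift e J I.
Proof.
case=> dI dJ low up a aJ; have [ad|da] := leP (d + e) a.
  by exists (a - e) => //; apply: up; rewrite ?subrK ?lerBrDr.
by exists d => //; rewrite lerBlDr ltW.
Qed.

(** The composite of two nonzero morphisms of interval modules is nonzero at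
    each parameter where source and target are alive. *)
Lemma overlap_mid e I J K d d' a : overlap e I J d -> overlap e J K d' ->
  a \in rset I -> a + e + e \in rset K -> a + e \in rset J.
Proof.
move=> [_ dJ low _] [d'J _ _ up] aI aK.
have [/low/(_ aI)//|/ltW da] := leP a d.
have [/up/(_ aK)//|/ltW ad] := leP d' (a + e).
by apply: (rset_between dJ d'J); rewrite ?lerD2r.
Qed.

(** Naturality propagates a nonzero coefficient to smaller parameters as long
    as the source is alive, and to larger ones as long as the target is. *)
Lemma mat_morphism_scalar (T T' : finType) e (I : T -> rinterval R)
    (J : T' -> rinterval R) (M : T -> T' -> R -> F) :
  mat_morphism e I J M -> exists P : T -> T' -> F, forall i j,
    (forall a, M i j a = P i j * ((a \in rset (I i)) && (a + e \in rset (J j)))%:R) /\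
    (P i j != 0 -> exists d, overlap e (I i) (J j) d).
Proof.
move=> mM.
suff ex i j : exists p : F,
    (forall a, M i j a = p * ((a \in rset (I i)) && (a + e \in rset (J j)))%:R) /\
    (p != 0 -> exists d, overlap e (I i) (J j) d).
  by exists (fun i j => projT1 (cid (ex i j))) => i j; apply: (projT2 (cid (ex i j))).
have [[d Md]|M0] := pselect (exists d, M i j d != 0); last first.
  exists 0; split=> [a|]; last by rewrite eqxx.
  by rewrite mul0r; apply/eqP/negPn/negP => Ma; apply: M0; exists a.
have [dI dJ] := mat_supp mM Md.
have low c : c <= d -> c \in rset (I i) -> M i j c = M i j d.
  by move=> cd cI; have := mat_natural mM i j cd; rewrite cI dJ !mul1r.
have up c : d <= c -> c + e \in rset (J j) -> M i j c = M i j d.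
  by move=> dc cJ; have := mat_natural mM i j dc; rewrite cJ dI !mul1r.
exists (M i j d); split=> [a|_]; last first.
  exists d; split=> // c dc cX.
    by have [] // := @mat_supp _ _ _ _ _ _ _ _ mM i j c; rewrite low.
  by have [] // := @mat_supp _ _ _ _ _ _ _ _ mM i j c; rewrite up.
case: (boolP (_ && _)) => [/andP[aI aJ]|na]; last first.
  rewrite mulr0; apply/eqP; apply: contraNT na => /(mat_supp mM)[-> ->] //.
by rewrite mulr1; have [ad|/ltW da] := leP a d; [apply: low|apply: up].
Qed.

Definition matchable_pairs (T T' : finType) (e : R) (I : T -> rinterval R)
    (J : T' -> rinterval R) : {set T * T'} :=
  [set p | `[< matchable e (I p.1) (J p.2) >]]%SET.

Lemma in_matchable_pairs (T T' : finType) (e : R) (I : T -> rinterval R)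
    (J : T' -> rinterval R) i j :
  ((i, j) \in matchable_pairs e I J) = `[< matchable e (I i) (J j) >].
Proof. by rewrite finset.in_set. Qed.

(** Stability for non-negligible intervals, by linear algebra.  The scalar
    matrices [P] and [Q] of the interleaving satisfy the hypothesis of
    [unitriangular_product_card]: by [close_to_end] every nonzero term passes
    through a neighbour of [A], so the sum over neighbours is the full sum. *)
Lemma card_significant (T T' : finType) (e e' : R) (I : T -> rinterval R)
    (J : T' -> rinterval R) (A : {set T}) :
  0 <= e -> e < e' -> mat_interleaved F e I J ->
  (forall i, i \in A -> ~ negligible e' (I i)) ->
  (#|A| <= #|nbhd (matchable_pairs e' I J) A|)%N.
Proof.
move=> e_ge0 lt_ee' [M [N [mM mN comp _]]] sigA.
have [P PE] := mat_morphism_scalar mM; have [Q QE] := mat_morphism_scalar mN.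
set C := nbhd _ _.
apply: (unitriangular_product_card (key := fun i => itv_key (I i)) (P := P) (Q := Q)).
move=> i i' iA i'A key_le.
have inC j k : k \in A -> close e' (I k) (J j) -> j \in C.
  move=> kA cl; apply/nbhdP; exists k => //.
  by rewrite in_matchable_pairs; apply/asboolP; left.
have viaC j : P i j * Q j i' != 0 -> j \in C.
  rewrite mulf_eq0 negb_or => /andP[/(PE i j).2[d o] /(QE j i').2[d' o']].
  have [dI dJ _ _] := o; have [_ d'I _ _] := o'.
  have [cl|cl] := close_to_end (overlap_lower o) (overlap_upper o)
    (overlap_lower o') (overlap_upper o') key_le lt_ee' dI dJ d'I.
    exact: inC cl.
  exact: inC cl.
have [[a aI aI']|none] := pselect (exists2 a, a \in rset (I i) &
    a + e + e \in rset (I i')); last first.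
  have [ii'|ii'] := eqVneq i i'.
    subst i'; have /existsNP[x /not_implyP[xI /negP/negPn xI']] := sigA i iA.
    by exfalso; apply: none; exists x => //; apply: (rset_between xI xI'); lra.
  rewrite big1 // => j _; apply/eqP; apply: contrapT => /negP.
  rewrite mulf_eq0 negb_or => /andP[/(PE i j).2[d o] /(QE j i').2[d' o']].
  apply: none; apply: (composite_nonzero (overlap_lower o) (overlap_upper o)
    (overlap_lower o') (overlap_upper o') key_le lt_ee'); exact: sigA.
transitivity (\sum_j M i j a * N j i' (a + e)); last first.
  rewrite comp aI /=; have [ii'|//] := eqVneq i i'.
  by subst i'; rewrite aI'.
rewrite big_mkcond; apply: eq_bigr => j _.
rewrite (PE i j).1 (QE j i').1 aI aI' andbT /=.
have [PQ|PQ] := eqVneq (P i j * Q j i') 0.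
  by rewrite mulrACA PQ mul0r if_same.
rewrite viaC //.
move: PQ; rewrite mulf_eq0 negb_or => /andP[/(PE i j).2[d o] /(QE j i').2[d' o']].
by rewrite (overlap_mid o o' aI aI') !mulr1.
Qed.

(** In Hall's condition, a set [S] with a negligible member is handled from the
    other side: the complement of its neighbourhood has no negligible member,
    and its neighbours lie outside [S]. *)
Lemma interleaved_matching (T T' : finType) (e e' : R) (I : T -> rinterval R)
    (J : T' -> rinterval R) : 0 <= e -> e < e' -> #|T| = #|T'| ->
  mat_interleaved F e I J ->
  exists f : T -> T', bijective f /\ forall i, matchable e' (I i) (J (f i)).
Proof.
move=> e_ge0 lt_ee' cardT IJ.
have hall (S : {set T}) : (#|S| <= #|nbhd (matchable_pairs e' I J) S|)%N.
  have [[i0 i0S neg0]|sig] := pselect (exists2 i, i \in S & negligible e' (I i)).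
    set C := nbhd _ S.
    have sigC j : j \in (~: C)%SET -> ~ negligible e' (J j).
      rewrite finset.in_setC => /negP jC neg; apply: jC; apply/nbhdP; exists i0 => //.
      by rewrite in_matchable_pairs; apply/asboolP; right.
    have leC := card_significant e_ge0 lt_ee' (mat_interleaved_sym IJ) sigC.
    have sub : nbhd (matchable_pairs e' J I) (~: C)%SET \subset (~: S)%SET.
      apply/fintype.subsetP => i /nbhdP[j]; rewrite !finset.in_setC => jC.
      rewrite in_matchable_pairs => /asboolP/matchable_sym ji.
      apply: contraNN jC => iS; apply/nbhdP; exists i => //.
      by rewrite in_matchable_pairs; apply/asboolP.
    rewrite -(leq_add2r #|(~: S)%SET|) cardsC cardT -(cardsC C) leq_add2l.
    exact: leq_trans leC (subset_leq_card sub).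
  by apply: (card_significant e_ge0 lt_ee' IJ) => i iS neg; apply: sig; exists i.
have [f [injf fE]] := hall_marriage hall; exists f; split.
  by apply: inj_card_bij => //; rewrite cardT.
by move=> i; have := fE i; rewrite in_matchable_pairs => /asboolP.
Qed.
End Matchings.

(** * The isometry *)

Section Barcodes.
Variable R : realType.
Implicit Types A B : fin_barcode R.

Definition barcode_itv A (i : nat) : rinterval R :=
  nth (itv_empty R) (enum_mset A) i.

(** The two padded barcodes are indexed by ordinals, on which [barcode_itv]
    supplies the empty intervals as default values. *)
Lemma occ_padded_bij A B : exists g : occ (padded A B) -> 'I_(size A + size B),
  bijective g /\ forall x, barcode_itv A (g x) = occ_itv x.
Proof.
rewrite -(size_nseq (size B) (itv_empty R)) -size_cat.
have [|g [bg gE]] := occurrence_bij (itv_empty R)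
    (s := enum_mset A ++ nseq (size B) (itv_empty R)) (c := padded A B).
  move=> x; rewrite count_cat count_nseq /= /padded msetE2 msetnE eq_sym.
  by rewrite -count_mem_mset; case: eqP; rewrite ?mul1n ?mul0n.
exists g; split=> // x; rewrite /occ_itv -gE nth_cat nth_nseq if_same.
by case: ltnP => // le; rewrite /barcode_itv nth_default.
Qed.

Lemma matching_cost_ge0 (F : fieldType) A B (f : stable_bijection A B) :
  (0 <= matching_cost F f)%E.
Proof. by apply: ereal_sup_ubound; left. Qed.

End Barcodes.

Section Isometry.
Variables (R : realType) (F : fieldType) (B B' : fin_barcode R).

Let basisB : interval_basis (chi F B)
    (fun i : 'I_(size B + size B') => barcode_itv B i) :=
  chi_seq_basis F (leq_addr (size B') (size B)).

Let basisB' : interval_basis (chi F B')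
    (fun i : 'I_(size B' + size B) => barcode_itv B' i) :=
  chi_seq_basis F (leq_addr (size B) (size B')).

Lemma interleaving_le_bottleneck :
  (interleaving_distance (chi F B) (chi F B') <= bottleneck_distance F B B')%E.
Proof.
apply: le_ereal_inf_tmp => _ [f _ <-].
have := matching_cost_ge0 F f.
case cost : (matching_cost F f) => [r| |] // r_ge0; last exact: leey.
apply/lee_addgt0Pr => d d_gt0; apply: ereal_inf_lbound.
exists (r + d) => //=.
have rd_ge0 : 0 <= r + d by move: r_ge0; rewrite lee_fin; lra.
apply/(interleavedP basisB basisB'); split=> //.
have [g [bg gE]] := occ_padded_bij B B'.
have [g' [bg' g'E]] := occ_padded_bij B' B.
have [h gK hK] := bg.
apply: (bijection_interleaved (h := g' \o f \o h)).
  apply: bij_comp; first by apply: bij_comp bg' (sbijP f).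
  by exists g.
move=> i /=; rewrite g'E -{1}(hK i) gE; set x := h i.
have : (interleaving_distance (chi_itv F (occ_itv x)) (chi_itv F (occ_itv (f x)))
    < (r + d)%:E)%E.
  apply: (@le_lt_trans _ _ r%:E); last by rewrite lte_fin; lra.
  by rewrite -cost; apply: ereal_sup_ubound; right; exists x.
move=> /ereal_inf_lt[_ [e /= eint <-]]; rewrite lte_fin => e_lt.
have /(interleavedP (chi_itv_basis F _) (chi_itv_basis F _))[e_ge0 eI] := eint.
exact: mat_interleaved_le e_ge0 (ltW e_lt) eI.
Qed.

Lemma bottleneck_le_interleaving :
  (bottleneck_distance F B B' <= interleaving_distance (chi F B) (chi F B'))%E.
Proof.
apply: le_ereal_inf_tmp => _ [e /= eint <-].
have /(interleavedP basisB basisB')[e_ge0 eI] := eint.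
apply/lee_addgt0Pr => d d_gt0.
have ed_ge0 : 0 <= e + d by lra.
have lt_ed : e < e + d by rewrite ltrDl.
have cardE : #|'I_(size B + size B')| = #|'I_(size B' + size B)|.
  by rewrite !card_ord addnC.
have [f [bf fE]] := interleaved_matching e_ge0 lt_ed cardE eI.
have [g [bg gE]] := occ_padded_bij B B'.
have [g' [[h' g'K h'K] g'E]] := occ_padded_bij B' B.
have bsb : bijective (h' \o f \o g).
  by apply: bij_comp bg; apply: bij_comp bf; exists g'.
apply: (@le_trans _ _ (matching_cost F (StableBijection bsb))).
  by apply: ereal_inf_lbound; exists (StableBijection bsb).
apply: ge_ereal_sup => _ [->|[x _ <-]]; first by rewrite -EFinD lee_fin.
apply: ereal_inf_lbound; exists (e + d) => //=.
by apply: matchable_interleaved => //; rewrite -gE -g'E h'K; apply: fE.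
Qed.

End Isometry.

Theorem theorem4p16 (R : realType) (F : fieldType) (B B' : fin_barcode R) :
  interleaving_distance (chi F B) (chi F B') = bottleneck_distance F B B'.
Proof.
apply/eqP; rewrite eq_le interleaving_le_bottleneck.
exact: bottleneck_le_interleaving.
Qed.
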